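(* There exists an absolute constant $C>0$ such that for every integer $n\ge 1$ and every unconditional $o$-symmetric convex body $K\subset\mathbb{R}^n$ there exists a GAP $\mathrm{P}(A,b)\subseteq K$ which satisfies both (i) $\displaystyle K\cap\mathbb{Z}^n\subseteq \mathrm{P}(A,\, n\,b)$, and (ii) $\displaystyle |K\cap\mathbb{Z}^n| < (Cn)^{n}\,|\mathrm{P}(A,b)|.$
   Context: An $o$-symmetric convex body in $\mathbb{R}^n$ is a compact convex set $K\subset\mathbb{R}^n$ with non-empty interior and $K=-K$. It is called unconditional if it is symmetric with respect to all coordinate hyperplanes, i.e. invariant under changing the sign of any coordinate. A (symmetric) generalized arithmetic progression, GAP for short, is a set of the form $$\mathrm{P}(A,b)=\{A z : z\in\mathbb{Z}^n,\ |z_i|\le b_i,\ 1\le i\le n\},$$ where $A\in\mathbb{Z}^{n\times n}$ with $\det A\neq 0$, and $b\in\mathbb{R}^n$ (the entries of $b$ need not be integers). For a real $t$, $\mathrm{P}(A,tb)$ is the set with $b$ replaced by the vector $tb$. $|\cdot|$ applied to a finite set denotes its cardinality. *)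

(* Defs.v *)
From HB Require Import structures.
From mathcomp Require Import all_boot all_order all_algebra finmap.
From mathcomp Require Import all_classical all_reals all_analysis.

Set Implicit Arguments.
Unset Strict Implicit.
Unset Printing Implicit Defensive.

Import Order.TTheory GRing.Theory Num.Theory.
Import numFieldNormedType.Exports.

Local Open Scope classical_set_scope.
Local Open Scope ring_scope.

(* The topology on 'cV[R]_n is that of the max norm, hence the Euclidean one. *)
Definition osym_convex_body (R : realType) (n : nat) (K : set 'cV[R]_n) : Prop :=
  [/\ compact K, convex_set K, K° !=set0 & [set - x | x in K] = K].

Definition flip_coord (R : realType) (n : nat) (i : 'I_n) (x : 'cV[R]_n) :
    'cV[R]_n :=
  \col_j (if j == i then - x j 0 else x j 0).

Definition unconditional (R : realType) (n : nat) (K : set 'cV[R]_n) : Prop :=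
  forall i : 'I_n, flip_coord i @` K = K.

Definition int_lattice (R : realType) (n : nat) : set 'cV[R]_n :=
  [set map_mx intr z | z in [set: 'cV[int]_n]].
Arguments int_lattice : clear implicits.

(* The condition det A != 0 is not built in. *)
Definition GAP (R : realType) (n : nat) (A : 'M[int]_n) (b : 'cV[R]_n) :
    set 'cV[R]_n :=
  [set map_mx intr (A *m z) | z in
    [set z : 'cV[int]_n | forall i, `|(z i 0)%:~R| <= b i 0]].

(* Meaningful for finite sets only: fset_set sends infinite sets to fset0.
   finite_GAP and finite_lattice_points cover the sets counted here. *)
Definition card_set (T : choiceType) (X : set T) : nat := #|` fset_set X|.

Lemma finite_int_box (R : realType) (n : nat) (b : 'cV[R]_n) :
  finite_set [set z : 'cV[int]_n | forall i, `|(z i ord0)%:~R| <= b i ord0].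
Proof.
pose N := (\max_(i < n) `|Num.floor (b i ord0)|%N)%N.
pose g (f : {ffun 'I_n -> 'I_(N.*2.+1)}) : 'cV[int]_n :=
  \col_i ((f i : nat)%:Z - N%:Z).
apply: (@sub_finite_set _ _ (g @` setT)); last first.
  exact/finite_image/finite_finset.
move=> z /= hz.
have bz i : (`|z i ord0| <= N)%N.
  have : `|z i ord0| <= Num.floor (b i ord0).
    by rewrite floor_ge_int intr_norm; exact: hz.
  move=> h; apply: (@leq_trans `|Num.floor (b i ord0)|%N).
    by rewrite -lez_nat !abszE (le_trans h)// ler_norm.
  exact: (@leq_bigmax _ (fun i => `|Num.floor (b i ord0)|%N)).
have z1 i : - N%:Z <= z i ord0 <= N%:Z.
  by rewrite -ler_norml -abszE lez_nat.
exists [ffun i => inord (absz (z i ord0 + N%:Z))] => //.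
apply/colP => i; rewrite !mxE ffunE.
have /andP[lo hi] := z1 i.
have p : 0 <= z i ord0 + N%:Z by rewrite -lerBlDr sub0r.
rewrite inordK; last first.
  rewrite ltnS -lez_nat abszE ger0_norm// -addnn PoszD.
  by rewrite lerD2r.
by rewrite abszE ger0_norm// addrK.
Qed.

Lemma finite_GAP (R : realType) (n : nat) (A : 'M[int]_n) (b : 'cV[R]_n) :
  finite_set (GAP A b).
Proof. exact/finite_image/finite_int_box. Qed.

Lemma finite_lattice_points (R : realType) (n : nat) (K : set 'cV[R]_n) :
  compact K -> finite_set (K `&` int_lattice R n).
Proof.
move=> /compact_bounded[M [_ hM]].
have := finite_int_box (const_mx (M + 1) : 'cV[R]_n).
move=> /(finite_image (map_mx intr : _ -> 'cV[R]_n)).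
apply: sub_finite_set => x [Kx [z _ zx]]; exists z => //= i.
rewrite mxE; have /= := hM (M + 1) _ x Kx; rewrite ltrDl ltr01 => /(_ isT).
apply: le_trans; rewrite -zx.
rewrite [leRHS]/Num.norm /= mx_normrE; apply/bigmax_geP; right => /=.
by exists (i, ord0) => //; rewrite mxE.
Qed.

(* Main.v *)
Require Import Defs.
From HB Require Import structures.
From mathcomp Require Import all_boot all_order all_algebra finmap.
From mathcomp Require Import all_classical all_reals all_analysis.
From mathcomp Require Import zify ring lra.

Set Implicit Arguments.
Unset Strict Implicit.
Unset Printing Implicit Defensive.

Import Order.TTheory GRing.Theory Num.Theory.
Import numFieldNormedType.Exports.

Local Open Scope classical_set_scope.
Local Open Scope ring_scope.

(** The progression is the set of integer points of an axis-parallel box, that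
    is, A is the identity matrix. Among the boxes prod_i [-|x_i|, |x_i|] with x
    in K, choose one of maximal volume, with corner a, and let b_i = |a_i|.
    Such a box exists by compactness, and its volume is positive because K has
    interior points.

    - The box lies in K, because an unconditional convex set contains with x
      every y such that |y_i| <= |x_i| for all i ([unconditional_solid]).

    - Its dilate by n contains K ([maximal_box_absorbs]). Indeed, if x in K had
      |x_k| > n |a_k|, then |x_k| e_k would lie in K too, and moving the corner
      b slightly towards |x_k| e_k would multiply the volume by
      (1 - t)^(n-1) (1 - t + t |x_k| / |a_k|) = 1 + t (|x_k| / |a_k| - n) + O(t^2),
      which exceeds 1 for small t > 0, against maximality.

    - The two boxes have prod_i (2 floor(n b_i) + 1) and
      prod_i (2 floor(b_i) + 1) integer points ([card_box_GAP]). Each ratio of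
      factors is less than 2 n ([double_floor_dilate]), so C = 2 will do. *)

(** * Unconditional convex sets *)

Section UnconditionalConvexSets.
Context {R : realType} {n : nat} {K : set 'cV[R]_n}.
Hypotheses (Kconv : convex_set K) (Kunc : unconditional K).

Lemma convex_comb_mem (x y : 'cV[R]_n) (t : R) :
  0 <= t <= 1 -> K x -> K y -> K (t *: x + (1 - t) *: y).
Proof.
move=> /andP[t0 t1] Kx Ky.
have := Kconv (Itv01 t0 t1) (mem_set Kx) (mem_set Ky).
by rewrite inE.
Qed.

(** The new point lies on the segment from x to its reflection in the
    hyperplane orthogonal to the i-th axis. *)
Lemma unconditional_shrink_coord (x : 'cV[R]_n) (i : 'I_n) (c : R) :
  K x -> `|c| <= `|x i 0| -> K (\col_j if j == i then c else x j 0).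
Proof.
move=> Kx cx.
have Kfx : K (flip_coord i x) by rewrite -(Kunc i); exists x.
have h1 : `|c / x i 0| <= 1.
  rewrite normf_div; have [x0|x0] := eqVneq (x i 0) 0.
    by rewrite x0 normr0 invr0 mulr0.
  by rewrite ler_pdivrMr ?normr_gt0 // mul1r.
(* The weight solves s * x_i - (1 - s) * x_i = c. If x_i = 0 then c = 0, and
   every weight works; division by zero then yields 1 / 2. *)
have ht : 0 <= (1 + c / x i 0) / 2 <= 1.
  by move: h1; rewrite ler_norml => /andP[? ?]; apply/andP; split; lra.
have := convex_comb_mem ht Kx Kfx.
congr K; apply/colP => j; rewrite !mxE; case: eqP => [->|_]; last by ring.
have [x0|x0] := eqVneq (x i 0) 0; last by field.
by move: cx; rewrite x0 normr0 normr_le0 => /eqP ->; ring.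
Qed.

(** One coordinate is shrunk at a time. Allowing an arbitrary list s of
    coordinates, with repetitions, is what makes the induction immediate. *)
Lemma unconditional_solid (x y : 'cV[R]_n) :
  K x -> (forall i, `|y i 0| <= `|x i 0|) -> K y.
Proof.
move=> Kx yx.
suff H (s : seq 'I_n) : K (\col_i if i \in s then y i 0 else x i 0).
  have := H (enum 'I_n); congr K.
  by apply/colP => i; rewrite !mxE mem_enum.
elim: s => [|i s Ks].
  by congr K: Kx; apply/colP => i; rewrite !mxE.
have yi : `|y i 0| <= `|(\col_i if i \in s then y i 0 else x i 0) i 0|.
  by rewrite mxE; case: ifP.
have := unconditional_shrink_coord Ks yi.
congr K; apply/colP => j; rewrite !mxE in_cons.
by case: eqVneq => [->|].
Qed.

End UnconditionalConvexSets.

(** * Boxes of maximal volume *)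

Lemma bernoulli_ineq (R : realType) (m : nat) (t : R) :
  0 <= t <= 1 -> 1 - m%:R * t <= (1 - t) ^+ m.
Proof.
move=> /andP[t0 t1]; elim: m => [|m IH]; first by rewrite expr0; lra.
have h : (1 - m%:R * t) * (1 - t) <= (1 - t) ^+ m.+1.
  by rewrite exprSr ler_wpM2r // subr_ge0.
apply: le_trans h; rewrite -natr1.
have : 0 <= m%:R * t * t by rewrite !mulr_ge0.
lra.
Qed.

(** The one-variable inequality behind maximality: when one edge of a box moves
    from a towards x and the other n - 1 edges are scaled by 1 - t, the volume
    changes, to first order, by the factor 1 + t (x / a - n). *)
Lemma transfer_increases_product (R : realType) (n : nat) (a x : R) :
  (0 < n)%N -> 0 < a -> n%:R * a < x ->
  exists2 t : R, 0 <= t <= 1 & a < (t * x + (1 - t) * a) * (1 - t) ^+ n.-1.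
Proof.
move=> n0 a0 nax.
have nE : n%:R = 1 + n.-1%:R :> R by rewrite -(prednK n0) -natr1 /= addrC.
set m := n.-1 in nE *.
have m0 : 0 <= m%:R :> R by [].
have nR : 0 < n%:R :> R by rewrite ltr0n.
have na0 : 0 < n%:R * a by rewrite mulr_gt0.
have x0 : 0 < x by lra.
have ax : a < x by apply: le_lt_trans nax; rewrite ler_peMl ?(ltW a0)// nE; lra.
have nx0 : 0 < n%:R * x by rewrite mulr_gt0.
(* With m = n - 1, Bernoulli bounds the right-hand side below by
   a + t * ((x - n * a) - m * t * (x - a)). The choice
   n * x * t = x - n * a makes the inner bracket positive. *)
pose t := (x - n%:R * a) / (n%:R * x).
have tE : t * (n%:R * x) = x - n%:R * a by rewrite /t divfK // gt_eqF.
have t0 : 0 < t by rewrite divr_gt0 // subr_gt0.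
have t1 : t <= 1.
  rewrite ler_pdivrMr // mul1r nE.
  have : 0 <= m%:R * x by rewrite mulr_ge0 // ltW.
  by move: na0; rewrite nE; lra.
have t01 : 0 <= t <= 1 by rewrite t1 ltW.
clearbody t.
exists t => //.
have B := bernoulli_ineq m t01.
have y0 : 0 <= t * x + (1 - t) * a.
  by apply: addr_ge0; apply: mulr_ge0; rewrite ?subr_ge0 //; exact: ltW.
apply: lt_le_trans (ler_wpM2l y0 B).
rewrite -subr_gt0.
have -> : (t * x + (1 - t) * a) * (1 - m%:R * t) - a
   = t * (t * x + m%:R * (t * a)).
  have -> : t * x + m%:R * (t * a) = t * (n%:R * x) - m%:R * t * (x - a).
    by rewrite nE; ring.
  by rewrite tE nE; ring.
apply: mulr_gt0 => //; apply: ltr_wpDr; last exact: mulr_gt0.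
by rewrite !mulr_ge0 // ?(ltW t0) ?(ltW a0).
Qed.

Section MaximalBox.
Context {R : realType} {n : nat} {K : set 'cV[R]_n}.
Hypotheses (Kconv : convex_set K) (Kunc : unconditional K).

(** The volume of the box with corner x, up to the factor 2 ^ n. *)
Definition box_volume (x : 'cV[R]_n) : R := \prod_i `|x i 0|.

Lemma continuous_box_volume : continuous box_volume.
Proof.
apply: continuous_big => [|i _ x]; first exact: mul_continuous.
apply: continuous_comp; last exact: norm_continuous.
exact: coord_continuous.
Qed.

(** An interior point can be pushed away from every coordinate hyperplane at
    once, each coordinate moving away from 0. *)
Lemma interior_box_volume_gt0 : K° !=set0 -> exists2 x, K x & 0 < box_volume x.
Proof.
move=> [x /nbhs_ballP[e /= e0 xeK]].
have e20 : 0 < e / 2 by rewrite divr_gt0.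
exists (\col_i (x i 0 + if 0 <= x i 0 then e / 2 else - (e / 2))).
  apply: xeK; split=> // i j; rewrite !ord1 mxE /ball /= opprD addNKr normrN.
  case: ifP => _; rewrite ?normrN gtr0_norm //; lra.
apply: prodr_gt0 => i _; rewrite mxE normr_gt0.
case: (leP 0 (x i 0)) => h; [apply: lt0r_neq0|apply: ltr0_neq0]; lra.
Qed.

(** If |x_k| were larger, then the point |x_k| e_k, which belongs to K by
    solidity, would give a direction in which the volume increases. *)
Lemma maximal_box_absorbs (a x : 'cV[R]_n) (k : 'I_n) :
  K a -> 0 < box_volume a ->
  (forall y, K y -> box_volume y <= box_volume a) ->
  K x -> `|x k 0| <= n%:R * `|a k 0|.
Proof.
move=> Ka va amax Kx.
have a0 i : 0 < `|a i 0|.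
  rewrite normr_gt0; apply: contraTneq va => ai0.
  by rewrite /box_volume (bigD1 i) //= ai0 normr0 mul0r ltxx.
rewrite leNgt; apply/negP => nax.
have n0 : (0 < n)%N := leq_ltn_trans (leq0n k) (ltn_ord k).
have [t t01 ht] := transfer_increases_product n0 (a0 k) nax.
pose p : 'cV[R]_n := \col_j if j == k then `|x k 0| else 0.
have Kp : K p.
  apply: (unconditional_solid Kconv Kunc Kx) => i; rewrite mxE.
  by case: eqP => [->|_]; rewrite ?normr_id ?normr0.
have Kb : K (\col_i `|a i 0|).
  by apply: (unconditional_solid Kconv Kunc Ka) => i; rewrite mxE normr_id.
have := amax _ (convex_comb_mem Kconv t01 Kp Kb).
apply/negP; rewrite -ltNge /box_volume (bigD1 k) //= [ltRHS](bigD1 k) //=.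
have /andP[t0 t1] := t01.
have -> : \prod_(i < n | i != k) `|(t *: p + (1 - t) *: \col_i `|a i 0|) i 0|
    = (1 - t) ^+ n.-1 * \prod_(i < n | i != k) `|a i 0|.
  have -> : (1 - t) ^+ n.-1 = \prod_(i < n | i != k) (1 - t).
    by rewrite prodr_const cardC1 card_ord.
  rewrite -big_split; apply: eq_bigr => i /negbTE ik /=.
  rewrite !mxE ik mulr0 add0r ger0_norm // mulr_ge0 // subr_ge0 //.
rewrite !mxE eqxx [ `|t * _ + _| ]ger0_norm.
  by rewrite mulrA ltr_pM2r // prodr_gt0.
by rewrite addr_ge0 // mulr_ge0 // subr_ge0.
Qed.

End MaximalBox.

(** * Counting integer points of boxes *)

Lemma card_range_inj (T : finType) (U : choiceType) (f : T -> U) :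
  injective f -> card_set (range f) = #|T|.
Proof.
move=> finj; rewrite /card_set fset_set_image; last exact: finite_finset.
rewrite card_imfset // cardE.
apply/perm_size/uniq_perm; rewrite ?enum_uniq ?fset_uniq // => x.
by rewrite mem_enum in_fset_set ?in_setT; last exact: finite_finset.
Qed.

(** The box is the injective image of the product of the intervals
    {0, ..., 2 floor(b_i)}, shifted by floor(b_i) in the i-th coordinate. *)
Lemma card_box_GAP (R : realType) (n : nat) (b : 'cV[R]_n) :
  (forall i, 0 <= b i 0) ->
  card_set (GAP 1%:M b) = (\prod_i (`|Num.floor (b i 0)%R|.*2.+1))%N.
Proof.
move=> b0; pose m i : nat := `|Num.floor (b i 0)%R|%N.
pose T := {dffun forall i, 'I_(m i).*2.+1}.
pose g (f : T) : 'cV[R]_n := \col_i ((f i : nat)%:Z - (m i)%:Z)%:~R.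
have bE i (z : int) : (`|z%:~R| <= b i 0) = (`|z| <= m i)%N.
  rewrite -intr_norm -floor_ge_int -lez_nat abszE; congr (_ <= _).
  by rewrite /m gez0_abs // floor_ge0.
have -> : GAP 1%:M b = range g.
  apply/seteqP; split => [_ [z hz <-]|_ [f _ <-]].
    have zm i : (`|z i 0%R| <= m i)%N by rewrite -bE; exact: hz.
    exists [ffun i => inord `|(z i 0 + (m i)%:Z)%R|%N] => //.
    apply/colP => i; rewrite mul1mx !mxE ffunE inordK; last by have := zm i; lia.
    by congr intr; have := zm i; lia.
  exists (\col_i ((f i : nat)%:Z - (m i)%:Z)).
    by move=> i; rewrite mxE bE; have := ltn_ord (f i); lia.
  by rewrite mul1mx; apply/colP => i; rewrite !mxE.
rewrite card_range_inj; last first.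
  move=> f h /colP fh; apply/ffunP => i; apply/val_inj => /=.
  by have := fh i; rewrite !mxE => /intr_inj; lia.
rewrite card_dep_ffun foldrE big_map big_enum /=.
by apply: eq_bigr => i _; rewrite card_ord.
Qed.

(** From a < floor(a) + 1 comes floor(n a) + 1 <= n (floor(a) + 1), hence
    2 floor(n a) + 1 < 2 n (floor(a) + 1) <= 2 n (2 floor(a) + 1). *)
Lemma double_floor_dilate (R : realType) (n : nat) (a : R) :
  (0 < n)%N -> 0 <= a ->
  (`|Num.floor (n%:R * a)%R|.*2.+1 < 2 * n * `|Num.floor a|.*2.+1)%N.
Proof.
move=> n0 a0.
have fa0 : 0 <= Num.floor a by rewrite floor_ge0.
have fna0 : 0 <= Num.floor (n%:R * a) by rewrite floor_ge0 mulr_ge0.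
have lt : Num.floor (n%:R * a) < n%:Z * (Num.floor a + 1).
  rewrite floor_lt_int intrM ltr_pM2l ?ltr0n //; exact: floorD1_gt.
nia.
Qed.

(** * Integer points of an unconditional convex body *)

Theorem proposition1p3 (R : realType) :
  exists C : R, 0 < C /\
    forall (n : nat) (K : set 'cV[R]_n),
      (1 <= n)%N -> osym_convex_body K -> unconditional K ->
      exists (A : 'M[int]_n) (b : 'cV[R]_n),
        [/\ \det A != 0,
            GAP A b `<=` K,
            K `&` int_lattice R n `<=` GAP A (n%:R *: b) &
            (card_set (K `&` int_lattice R n))%:R
              < (C * n%:R) ^+ n * (card_set (GAP A b))%:R].
Proof.
exists 2; split=> // n K n0 [Kcpt Kconv Kint _] Kunc.
have [x0 Kx0 vx0] := interior_box_volume_gt0 Kint.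
have [a aK amax] : exists2 a, a \in K &
    forall y, y \in K -> box_volume y <= box_volume a.
  apply: compact_EVT_max => //; first by exists x0.
  exact/continuous_subspaceT/continuous_box_volume.
have Ka : K a by rewrite inE in aK.
have {}amax y : K y -> box_volume y <= box_volume a.
  by move=> Ky; apply/amax/mem_set.
have va : 0 < box_volume a by apply: lt_le_trans vx0 (amax _ Kx0).
pose b : 'cV[R]_n := \col_i `|a i 0|.
have b0 i : 0 <= b i 0 by rewrite mxE.
have sub : K `&` int_lattice R n `<=` GAP 1%:M (n%:R *: b).
  move=> x [Kx [z _ zx]]; exists z; last by rewrite mul1mx.
  move=> i; rewrite !mxE.
  have := maximal_box_absorbs Kconv Kunc i Ka va amax Kx.
  by rewrite -zx mxE.
exists 1%:M, b; split=> //.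
- by rewrite det1 oner_eq0.
- move=> _ [z hz <-]; rewrite mul1mx.
  apply: (unconditional_solid Kconv Kunc Ka) => i.
  by rewrite mxE; have := hz i; rewrite !mxE.
- have le : (card_set (K `&` int_lattice R n)
             <= card_set (GAP 1%:M (n%:R *: b)))%N.
    apply: fsubset_leq_card; rewrite -fset_set_sub //.
    + exact: finite_lattice_points.
    + exact: finite_GAP.
  apply: le_lt_trans (_ : (card_set (GAP 1%:M (n%:R *: b)))%:R < _).
    by rewrite ler_nat.
  rewrite !card_box_GAP //; last by move=> i; rewrite mxE mulr_ge0.
  have -> : (2 * n%:R : R) ^+ n = \prod_(i < n) (2 * n)%:R.
    by rewrite prodr_const card_ord natrM.
  rewrite !natr_prod -big_split /=; apply: ltr_prod.
    by apply/hasP; exists (Ordinal n0); rewrite ?mem_index_enum.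
  move=> i _; rewrite ler0n /= -natrM ltr_nat.
  by rewrite [(n%:R *: b) i 0]mxE double_floor_dilate.
Qed.
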